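(* (a) The number of up-down runs $\mathrm{udr}$ is shuffle-compatible. (b) The linear map on $\mathcal{A}_{\mathrm{udr}}$ defined by $[\pi]_{\mathrm{udr}}\mapsto\frac{2^{\mathrm{udr}(\pi)-1}t^{\mathrm{udr}(\pi)}(1+t^2)^{|\pi|-\mathrm{udr}(\pi)}}{(1-t)^2(1-t^2)^{|\pi|-1}}x^{|\pi|}$ if $|\pi|\ge1$ and $[\pi]_{\mathrm{udr}}\mapsto1/(1-t)$ if $|\pi|=0$ is a $\mathbb{Q}$-algebra isomorphism from $\mathcal{A}_{\mathrm{udr}}$ to the span of $\{\frac1{1-t}\}\cup\{\frac{2^{j-1}t^j(1+t^2)^{n-j}}{(1-t)^2(1-t^2)^{n-1}}x^n\}_{n\ge1,\,1\le j\le n}$, a subalgebra of $\mathbb{Q}[[t*]][x]$. (c) For $n\ge1$, the $n$th homogeneous component of $\mathcal{A}_{\mathrm{udr}}$ has dimension $n$.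
   Context: A permutation of length $n$ is a sequence $\pi=\pi_1\cdots\pi_n$ of distinct positive integers. A birun of $\pi$ is a maximal monotone consecutive subsequence; an up-down run of $\pi$ is either a birun or the single letter $\pi_1$ when $\pi_1>\pi_2$; $\mathrm{udr}(\pi)$ is the number of up-down runs. For disjoint permutations, $S(\pi,\sigma)$ is the set of shuffles (permutations of length $|\pi|+|\sigma|$ containing both as subsequences). A statistic $\mathrm{st}$ is shuffle-compatible if for disjoint $\pi,\sigma$ the multiset $\{\mathrm{st}(\tau):\tau\in S(\pi,\sigma)\}$ depends only on $\mathrm{st}(\pi),\mathrm{st}(\sigma),|\pi|,|\sigma|$; its shuffle algebra $\mathcal{A}_{\mathrm{st}}$ has basis the classes $[\pi]_{\mathrm{st}}$ of permutations with equal length and $\mathrm{st}$-value, product $[\pi]_{\mathrm{st}}[\sigma]_{\mathrm{st}}=\sum_{\tau\in S(\pi,\sigma)}[\tau]_{\mathrm{st}}$, graded by length. $\mathbb{Q}[[t*]][x]$ denotes polynomials in $x$ with coefficients formal power series in $t$, with multiplication ordinary in $x$ and the Hadamard product $(\sum a_nt^n)*(\sum b_nt^n)=\sum a_nb_nt^n$ in $t$. *)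

(* Defs.v *)
From HB Require Import structures.
From mathcomp Require Import all_boot all_order all_algebra.
From mathcomp Require Import finmap.
From mathcomp Require Import boolp classical_sets functions.
From mathcomp.multinomials Require Import monalg.

Set Implicit Arguments.
Unset Strict Implicit.
Unset Printing Implicit Defensive.

Import GRing.Theory.

Local Open Scope ring_scope.

Section Subspaces.
Variables (F : fieldType) (V : lmodType F).

Definition lspan (X : set V) : {pred V} := fun v =>
  `[< exists s : seq (F * V),
        (forall p, p \in s -> X p.2) /\ v = \sum_(p <- s) p.1 *: p.2 >].

Definition has_dim (S : {pred V}) (n : nat) : Prop :=
  exists b : 'I_n -> V,
    [/\ forall i, b i \in S,
        forall c : 'I_n -> F,
          \sum_(i < n) c i *: b i = 0 -> forall i, c i = 0
      & forall v, v \in S -> exists c : 'I_n -> F, v = \sum_(i < n) c i *: b i].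

End Subspaces.

Section Permutations.
Local Open Scope nat_scope.

Record permutation :=
  Permutation { word :> seq nat; _ : uniq word && all (leq 1) word }.

HB.instance Definition _ := [isSub for word].
HB.instance Definition _ := [Countable of permutation by <:].

Implicit Types p q r : permutation.

Lemma uniq_word p : uniq p.
Proof. by case: p => w /= /andP[]. Qed.

Lemma pos_word p x : x \in word p -> 0 < x.
Proof. by case: p => w /= /andP[_ /allP]; apply. Qed.

Definition empty_perm : permutation := @Permutation [::] isT.

Definition disjoint_perm p q : bool := ~~ has (mem (word p)) q.

(* The set S(p, q), for disjoint p and q, as a duplicate-free list; see mem_shuffles. *)
Definition shuffles p q : seq permutation :=
  pmap insub [seq w <- permutations (word p ++ word q)
                 | subseq p w && subseq q w].

Lemma uniq_cat_disjoint p q : uniq (word p ++ word q) = disjoint_perm p q.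
Proof. by rewrite cat_uniq !uniq_word andbT. Qed.

Lemma shuffles_uniq p q : uniq (shuffles p q).
Proof. by rewrite pmap_sub_uniq // filter_uniq // permutations_uniq. Qed.

Lemma mem_shuffles p q r : disjoint_perm p q ->
  (r \in shuffles p q) =
    [&& size r == size p + size q, subseq p r & subseq q r].
Proof.
move=> dpq; rewrite mem_pmap_sub mem_filter mem_permutations andbC.
case spr: (subseq p r); case sqr: (subseq q r); rewrite ?andbF //= !andbT.
apply/idP/idP => [/perm_size->|/eqP szr]; first by rewrite size_cat.
have upq : uniq (word p ++ word q) by rewrite uniq_cat_disjoint.
have sub : {subset word p ++ word q <= word r}.
  by move=> x; rewrite mem_cat => /orP[]; apply: mem_subseq.
rewrite perm_sym uniq_perm ?uniq_word //.
by case: (uniq_min_size upq sub); rewrite ?size_cat ?szr.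
Qed.

Lemma shuffles_perm p q r :
  r \in shuffles p q -> perm_eq r (word p ++ word q).
Proof. by rewrite mem_pmap_sub mem_filter mem_permutations => /andP[]. Qed.

Lemma shuffles_subseq p q r : r \in shuffles p q -> subseq p r && subseq q r.
Proof. by rewrite mem_pmap_sub mem_filter => /andP[]. Qed.

Lemma size_shuffles p q r : r \in shuffles p q -> size r = size p + size q.
Proof. by move=> /shuffles_perm/perm_size ->; rewrite size_cat. Qed.

Lemma shufflesC p q : perm_eq (shuffles p q) (shuffles q p).
Proof.
apply: uniq_perm; rewrite ?shuffles_uniq // => r.
rewrite !mem_pmap_sub !mem_filter !mem_permutations [subseq p _ && _]andbC.
by rewrite [in LHS]perm_sym perm_catC perm_sym.
Qed.

Lemma shuffles0p p : shuffles empty_perm p = [:: p].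
Proof.
apply: perm_small_eq => //; apply: uniq_perm; rewrite ?shuffles_uniq // => r.
rewrite mem_pmap_sub mem_filter mem_permutations sub0seq inE /= -val_eqE /=.
apply/andP/eqP => [[pr /perm_size szr]|->]; last by [].
by apply/esym/eqP; rewrite -(size_subseq_leqif pr).2 szr.
Qed.

Definition shuffles3 p q r : seq permutation :=
  [seq v | u <- shuffles q r, v <- shuffles p u].

Lemma shuffles3_uniq p q r : uniq (shuffles3 p q r).
Proof.
apply: allpairs_uniq_dep => [|u _|i j]; rewrite ?shuffles_uniq //.
move=> /allpairsPdep[u [v [uqr vpu ->]]] /allpairsPdep[u' [v' [uqr' vpu' ->]]] /=.
move=> vv; subst v'.
have uE w z : w \in shuffles q r -> z \in shuffles p w ->
    word w = [seq x <- z | x \in word q ++ word r].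
  move=> wqr /shuffles_subseq/andP[_ /(subseq_uniqP (uniq_word z)) wE].
  rewrite {1}wE.
  by apply: eq_filter => x /=; rewrite -(perm_mem (shuffles_perm wqr)).
suff -> : u = u' by [].
by apply: val_inj; rewrite /= (uE _ _ uqr vpu) (uE _ _ uqr' vpu').
Qed.

Lemma mem_shuffles3 p q r v :
  disjoint_perm q r -> disjoint_perm p q -> disjoint_perm p r ->
  (v \in shuffles3 p q r) =
    [&& perm_eq v (word p ++ word q ++ word r),
        subseq p v, subseq q v & subseq r v].
Proof.
move=> dqr dpq dpr.
apply/idP/idP => [/allpairsPdep[u [z [uqr vpu ->]]]|].
  have /andP[-> uv] := shuffles_subseq vpu.
  have /andP[qu ru] := shuffles_subseq uqr.
  rewrite !(subseq_trans _ uv) // !andbT.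
  apply: perm_trans (shuffles_perm vpu) _.
  by rewrite perm_cat2l shuffles_perm.
move=> /and4P[vpqr pv qv rv].
pose w := [seq x <- v | x \in word q ++ word r].
have wP : uniq w && all (leq 1) w.
  rewrite filter_uniq ?uniq_word //; apply/allP => x.
  by rewrite mem_filter => /andP[_ /pos_word].
pose u := Permutation wP.
have uqr : perm_eq u (word q ++ word r).
  apply: uniq_perm; rewrite ?uniq_word ?uniq_cat_disjoint // => x.
  rewrite mem_filter (perm_mem vpqr) [in RHS]mem_cat [X in _ && X]mem_cat.
  by rewrite mem_cat; case: (_ || _); rewrite ?orbT ?andbF.
apply/allpairsPdep; exists u, v; split=> //.
  rewrite mem_pmap_sub mem_filter mem_permutations uqr andbT /= !subseq_filter.
  rewrite qv rv !andbT; apply/andP; split; apply/allP => x xq.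
    by rewrite mem_cat xq.
  by rewrite mem_cat xq orbT.
rewrite mem_pmap_sub mem_filter mem_permutations pv filter_subseq /=.
by rewrite (perm_trans vpqr) // perm_cat2l perm_sym.
Qed.

Lemma disjoint_permC p q : disjoint_perm p q = disjoint_perm q p.
Proof. by rewrite -!uniq_cat_disjoint uniq_catC. Qed.

Lemma shuffles3C p q r :
  disjoint_perm q r -> disjoint_perm p q -> disjoint_perm p r ->
  perm_eq (shuffles3 p q r) (shuffles3 r p q).
Proof.
move=> dqr dpq dpr; apply: uniq_perm; rewrite ?shuffles3_uniq // => v.
rewrite !mem_shuffles3 // 1?disjoint_permC //.
rewrite [in RHS](perm_sym v) (perm_catC (word r)) -catA -(perm_sym v).
by congr (_ && _); rewrite [RHS]andbC andbA.
Qed.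

Lemma disjoint_shuffles p q r v :
  r \in shuffles p q -> disjoint_perm p v -> disjoint_perm q v ->
  disjoint_perm r v.
Proof.
move=> /shuffles_perm/perm_mem rpq dpv dqv; apply/hasPn => x xv.
rewrite inE rpq mem_cat negb_or.
by rewrite (hasPn dpv _ xv) (hasPn dqv _ xv).
Qed.

Definition same_order (v w : seq nat) : Prop :=
  size v = size w /\
  forall i j, i < size v -> j < size v ->
    (nth 0 v i < nth 0 v j) = (nth 0 w i < nth 0 w j).

(* A permutation statistic depends only on the relative order of the letters;
   this makes the product of two classes meaningful even when their
   representatives share letters. *)
Record statistic (T : eqType) := Statistic {
  stat_val :> permutation -> T;
  stat_order : forall p q, same_order p q -> stat_val p = stat_val q }.

Definition shuffle_compatible (T : eqType) (st : statistic T) : Prop :=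
  forall p p' q q' : permutation,
    disjoint_perm p q -> disjoint_perm p' q' ->
    size p = size p' -> size q = size q' -> st p = st p' -> st q = st q' ->
    perm_eq [seq st r | r <- shuffles p q] [seq st r | r <- shuffles p' q'].

End Permutations.

Section UpDownRuns.
Local Open Scope nat_scope.
Implicit Types w : seq nat.

(* (i, j) stands for the consecutive positions i <= k < j, counted from 0. *)
Definition intervals (n : nat) : seq (nat * nat) :=
  [seq ij <- [seq (i, j) | i <- iota 0 n.+1, j <- iota 0 n.+1] | ij.1 < ij.2].

Definition factor w (ij : nat * nat) : seq nat := drop ij.1 (take ij.2 w).

Definition monotone w : bool := sorted ltn w || sorted gtn w.

Definition is_birun w (ij : nat * nat) : bool :=
  monotone (factor w ij) &&
  all (fun kl => [&& kl.1 <= ij.1, ij.2 <= kl.2 & monotone (factor w kl)]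
                 ==> (kl == ij))
      (intervals (size w)).

Definition biruns w : seq (nat * nat) :=
  [seq ij <- intervals (size w) | is_birun w ij].

Definition num_udr w : nat :=
  size (biruns w) + (if w is x :: y :: _ then nat_of_bool (y < x) else 0).

(* The up-down runs of 871542 are 8, 871, 15 and 542. *)
Example num_udr_871542 : num_udr [:: 8; 7; 1; 5; 4; 2] = 4.
Proof. by []. Qed.

Lemma same_order_monotone v w ij :
  same_order v w -> monotone (factor v ij) = monotone (factor w ij).
Proof.
move=> [szvw vw].
have nthf (u : seq nat) k : k < size (factor u ij) ->
    nth 0 (factor u ij) k = nth 0 u (ij.1 + k) /\ ij.1 + k < size u.
  rewrite /factor size_drop size_take_min ltn_subRL leq_min => /andP[lt2 ltu].
  by rewrite nth_drop nth_take.
have szf : size (factor v ij) = size (factor w ij).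
  by rewrite /factor !size_drop !size_take szvw.
have adj k : k.+1 < size (factor v ij) ->
    (nth 0 (factor v ij) k < nth 0 (factor v ij) k.+1) =
      (nth 0 (factor w ij) k < nth 0 (factor w ij) k.+1) /\
    (nth 0 (factor v ij) k.+1 < nth 0 (factor v ij) k) =
      (nth 0 (factor w ij) k.+1 < nth 0 (factor w ij) k).
  move=> hk; have hk' := ltnW hk.
  have [-> l1] := nthf v _ hk; have [-> l2] := nthf v _ hk'.
  move: hk hk'; rewrite szf => hk hk'.
  have [-> _] := nthf w _ hk; have [-> _] := nthf w _ hk'.
  by rewrite !vw.
rewrite /monotone; congr (_ || _); apply/(sortedP 0)/(sortedP 0) => H k hk.
- by move: (H k); rewrite szf => /(_ hk); rewrite -szf in hk; rewrite /= (adj k hk).1.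
- by move: (H k); rewrite -szf => /(_ hk); rewrite /= (adj k hk).1.
- by move: (H k); rewrite szf => /(_ hk); rewrite -szf in hk; rewrite /= (adj k hk).2.
- by move: (H k); rewrite -szf => /(_ hk); rewrite /= (adj k hk).2.
Qed.

Lemma num_udr_order (p q : permutation) :
  same_order p q -> num_udr p = num_udr q.
Proof.
move=> pq; have [szpq lpq] := pq; rewrite /num_udr; congr (_ + _).
  rewrite /biruns szpq; congr size; apply: eq_filter => ij.
  rewrite /is_birun szpq (same_order_monotone _ pq); congr (_ && _).
  by apply: eq_all => kl; rewrite (same_order_monotone _ pq).
case: (word p) (word q) szpq lpq => [|x [|y u]] [|x' [|y' u']] //= _ l.
by have /= -> := l 1 0 isT isT.
Qed.

Definition udr : statistic nat := Statistic num_udr_order.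

End UpDownRuns.

Lemma linear_assoc (R : pzRingType) (V : lmodType R) (m : V -> V -> V)
    (linm : forall u, linear (m u)) u v k g h :
  m u (m v g) = m (m u v) g -> m u (m v h) = m (m u v) h ->
  m u (m v (k *: g + h)) = m (m u v) (k *: g + h).
Proof. by move=> Hg Hh; rewrite !linm Hg Hh. Qed.

Section MalgLift.
Variables (R : comNzRingType) (K : choiceType) (V : lmodType R).

Definition malg_lift (f : K -> V) (g : {malg R[K]}) : V :=
  \sum_(k <- msupp g) g@_k *: f k.

Lemma malg_liftEw f g (d : {fset K}) : (msupp g `<=` d)%fset ->
  malg_lift f g = \sum_(k <- d) g@_k *: f k.
Proof.
move=> gd; rewrite /malg_lift (big_fset_incl _ gd) //= => k _ /mcoeff_outdom ->.
by rewrite scale0r.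
Qed.

Lemma malg_lift_is_linear f : linear (malg_lift f).
Proof.
move=> c g h; pose d := (msupp g `|` msupp h)%fset.
have gd : (msupp g `<=` d)%fset by apply: fsubsetUl.
have hd : (msupp h `<=` d)%fset by apply: fsubsetUr.
have cd : (msupp (c *: g + h) `<=` d)%fset.
  apply: fsubset_trans (msuppD_le _ _) _; rewrite fsubUset hd andbT.
  exact: fsubset_trans (msuppZ_le _ _) gd.
rewrite !(malg_liftEw _ (d := d)) // scaler_sumr -big_split /=.
by apply: eq_bigr => k _; rewrite mcoeffD mcoeffZ scalerDl scalerA.
Qed.

HB.instance Definition _ f :=
  GRing.isLinear.Build R {malg R[K]} V *:%R (malg_lift f)
    (malg_lift_is_linear f).

Lemma malg_liftU f k : malg_lift f << k >> = f k.
Proof.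
by rewrite (malg_liftEw _ msuppU_le) big_seq_fset1 mcoeffUU scale1r.
Qed.

Lemma malg_ind (P : {malg R[K]} -> Prop) :
  P 0 -> (forall c g h, P g -> P h -> P (c *: g + h)) ->
  (forall k, P << k >>) -> forall g, P g.
Proof.
move=> P0 PD PU g; rewrite [g]monalgE.
elim/big_rec: _ => // k h _ Ph.
have -> : << g@_k *g k >> = g@_k *: << k >>.
  by apply/malgP => l; rewrite mcoeffZ !mcoeffU mulr_natr.
exact: PD.
Qed.

End MalgLift.

Section ShuffleAlgebra.
Variables (T : eqType) (st : statistic T).

(* Basis of the shuffle algebra: classes of equal length and equal st. *)
Definition st_equiv : rel permutation :=
  fun p q => (size p == size q) && (st p == st q).

Lemma st_equivP : equiv_class_of st_equiv.
Proof.
split=> [p | p q | q p r]; rewrite /st_equiv.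
- by rewrite !eqxx.
- by rewrite (eq_sym (size p)) (eq_sym (st p)).
- by move=> /andP[/eqP-> /eqP->].
Qed.

Canonical st_equivr := EquivRelPack st_equivP.

Definition st_class := {eq_quot st_equivr}%qT.

HB.instance Definition _ := Choice.on st_class.
HB.instance Definition _ := EqQuotient.on st_class.

Definition class_of (p : permutation) : st_class := (\pi p)%qT.

Lemma class_ofP p q : reflect (class_of p = class_of q) (st_equiv p q).
Proof. by apply: (iffP idP) => [/eqmodP|/eqmodP]. Qed.

Lemma st_equiv_repr p : st_equiv (repr (class_of p)) p.
Proof. by apply/class_ofP; rewrite /class_of reprK. Qed.

Lemma class_of_repr c : class_of (repr c) = c.
Proof. exact: reprK. Qed.

(* Translating every letter of q by sumn p makes it disjoint from p. *)
Section Shift.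
Local Open Scope nat_scope.

Lemma shift_subproof k (p : permutation) :
  uniq (map (addn k) p) && all (leq 1) (map (addn k) p).
Proof.
rewrite map_inj_uniq ?uniq_word; last exact: addnI.
by apply/allP => _ /mapP[x /pos_word xp ->]; rewrite ltn_addl.
Qed.

Definition shift k (p : permutation) : permutation :=
  Permutation (shift_subproof k p).

Lemma shift_same_order k p : same_order (shift k p) p.
Proof.
split=> [|i j]; rewrite size_map // => hi hj.
by rewrite !(nth_map 0) // ltn_add2l.
Qed.

Lemma st_equiv_shift k p : st_equiv (shift k p) p.
Proof.
by rewrite /st_equiv (stat_order st (shift_same_order k p)) size_map !eqxx.
Qed.

Lemma class_of_shift k p : class_of (shift k p) = class_of p.
Proof. by apply/class_ofP; apply: st_equiv_shift. Qed.

Lemma mem_leq_sumn (s : seq nat) x : x \in s -> x <= sumn s.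
Proof.
elim: s => //= y s IHs; rewrite inE => /orP[/eqP->|/IHs]; first exact: leq_addr.
by move=> h; apply: leq_trans h (leq_addl _ _).
Qed.

Lemma disjoint_permP (p q : permutation) :
  reflect (forall x, x \in word p -> x \in word q -> False) (disjoint_perm p q).
Proof.
apply: (iffP hasPn) => [H x xp /H /=|H x xq]; first by rewrite xp.
by apply/negP => xp; apply: H xp xq.
Qed.

Lemma disjoint_shift k (p q : permutation) :
  sumn p <= k -> disjoint_perm p (shift k q).
Proof.
move=> pk; apply/disjoint_permP => x /mem_leq_sumn xp /mapP[y /pos_word yq xe].
by move: (leq_trans xp pk); rewrite xe leqNgt -addn1 leq_add2l yq.
Qed.

End Shift.

(* The product of two basis classes, computed on one choice of disjoint
   representatives; by class_mulE any other choice gives the same result. *)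
Definition class_mul (c d : st_class) : {malg rat[st_class]} :=
  let p := repr c in let q := shift (sumn p) (repr d) in
  \sum_(r <- shuffles p q) << class_of r >>.

Definition shuffle_mul (a b : {malg rat[st_class]}) : {malg rat[st_class]} :=
  malg_lift (fun c => malg_lift (class_mul c) b) a.

Definition shuffle_one : {malg rat[st_class]} := << class_of empty_perm >>.

Definition shuffle_algebra (_ : shuffle_compatible st) := {malg rat[st_class]}.

Variable st_compat : shuffle_compatible st.

Lemma perm_map_factor (X : eqType) (Y Z : eqType) (f : X -> Y) (g : X -> Z)
    (s t : seq X) :
  (forall x y, x \in s ++ t -> y \in s ++ t -> f x = f y -> g x = g y) ->
  perm_eq (map f s) (map f t) -> perm_eq (map g s) (map g t).
Proof.
move=> fg; case stw: (s ++ t) => [|x0 w]; first by case: s t stw {fg} => [|? ?] [].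
pose h y := g (nth x0 (s ++ t) (index y (map f (s ++ t)))) => pst.
have hf x : x \in s ++ t -> h (f x) = g x.
  move=> xst; have fx : f x \in map f (s ++ t) by apply: map_f.
  have ix : (index (f x) (map f (s ++ t)) < size (s ++ t))%N.
    by rewrite -(size_map f) index_mem.
  apply: fg => //; first exact: mem_nth.
  by rewrite -(nth_map x0 (f x)) // nth_index.
have gE u : {subset u <= s ++ t} -> map g u = map h (map f u).
  by move=> ust; rewrite -map_comp; apply/eq_in_map => x /ust /hf /= ->.
rewrite (gE s) ?(gE t) => [|x xt|x xs]; first exact: perm_map.
  by rewrite mem_cat xt orbT.
by rewrite mem_cat xs.
Qed.

Lemma class_mulE p q : disjoint_perm p q ->
  class_mul (class_of p) (class_of q) =
    \sum_(r <- shuffles p q) << class_of r >>.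
Proof.
move=> dpq; rewrite /class_mul.
set p0 := repr _; set q0 := shift _ _.
have /andP[/eqP szp /eqP stp] : st_equiv p0 p by apply: st_equiv_repr.
have /andP[/eqP szq /eqP stq] : st_equiv q0 q.
  by apply/class_ofP; rewrite class_of_shift class_of_repr.
rewrite -!(big_map class_of predT (fun c => << c >>)); apply: perm_big.
apply: (perm_map_factor (f := st)).
  move=> u v; rewrite !mem_cat => hu hv stuv; apply/class_ofP.
  have szE w : (w \in shuffles p0 q0) || (w \in shuffles p q) ->
      size w = (size p + size q)%N.
    by case/orP=> /size_shuffles ->; rewrite ?szp ?szq.
  by apply/andP; split; apply/eqP; rewrite // (szE u) // (szE v).
exact: st_compat (disjoint_shift _ (leqnn _)) dpq szp szq stp stq.
Qed.

Lemma shuffle_mull b : linear (shuffle_mul^~ b).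
Proof. by move=> c g h; rewrite /shuffle_mul linearP. Qed.

Lemma shuffle_mulr a : linear (shuffle_mul a).
Proof.
move=> c g h; rewrite /shuffle_mul /malg_lift scaler_sumr -big_split /=.
apply: eq_bigr => k _; rewrite -!/(malg_lift _ _) linearP scalerDr.
by rewrite !scalerA mulrC.
Qed.

Lemma shuffle_mulU c d : shuffle_mul << c >> << d >> = class_mul c d.
Proof. by rewrite /shuffle_mul !malg_liftU. Qed.

Lemma shuffle_mul0l b : shuffle_mul 0 b = 0.
Proof. by rewrite /shuffle_mul linear0. Qed.

Lemma shuffle_mul0r a : shuffle_mul a 0 = 0.
Proof.
by have := shuffle_mulr a (-1) 0 0; rewrite scaler0 addr0 scaleN1r addNr.
Qed.

Lemma shuffle_mulDl : left_distributive shuffle_mul +%R.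
Proof. by move=> a b c; rewrite -[a]scale1r shuffle_mull !scale1r. Qed.

Lemma shuffle_mulDr : right_distributive shuffle_mul +%R.
Proof. by move=> a b c; rewrite -[b]scale1r shuffle_mulr !scale1r. Qed.

Lemma shuffle_mulC : commutative shuffle_mul.
Proof.
move=> a b; elim/malg_ind: a => [|k g h Hg Hh|c].
- by rewrite shuffle_mul0l shuffle_mul0r.
- by rewrite shuffle_mull shuffle_mulr Hg Hh.
elim/malg_ind: b => [|k g h Hg Hh|d].
- by rewrite shuffle_mul0l shuffle_mul0r.
- by rewrite shuffle_mull shuffle_mulr Hg Hh.
pose p := repr c; pose q := shift (sumn p) (repr d).
have cE : c = class_of p by rewrite class_of_repr.
have dE : d = class_of q by rewrite class_of_shift class_of_repr.
have dpq : disjoint_perm p q by apply: disjoint_shift.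
have dqp : disjoint_perm q p by rewrite disjoint_permC.
rewrite !shuffle_mulU cE dE !class_mulE //; apply: perm_big; apply: shufflesC.
Qed.

Lemma shuffle_mul_shuffles p q r :
  disjoint_perm q r -> disjoint_perm p q -> disjoint_perm p r ->
  shuffle_mul << class_of p >>
    (shuffle_mul << class_of q >> << class_of r >>) =
  \sum_(v <- shuffles3 p q r) << class_of v >>.
Proof.
move=> dqr dpq dpr; rewrite shuffle_mulU class_mulE //.
rewrite (big_morph _ (shuffle_mulDr _) (shuffle_mul0r _)).
rewrite big_allpairs_dep; apply: eq_big_seq => u uqr.
rewrite shuffle_mulU class_mulE // disjoint_permC.
by rewrite (disjoint_shuffles uqr) // disjoint_permC.
Qed.

Lemma shuffle_mulA : associative shuffle_mul.
Proof.
move=> x y z.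
elim/malg_ind: x => [|k g h Hg Hh|c].
- by rewrite !shuffle_mul0l.
- by rewrite !shuffle_mull Hg Hh.
elim/malg_ind: y => [|k g h Hg Hh|d].
- by rewrite !(shuffle_mul0l, shuffle_mul0r).
- by rewrite !(shuffle_mull, shuffle_mulr) Hg Hh.
elim/malg_ind: z => [|k g h Hg Hh|e].
- by rewrite !shuffle_mul0r.
- exact: (@linear_assoc _ _ _ shuffle_mulr << c >> << d >> k g h Hg Hh).
pose p := repr c; pose q := shift (sumn p) (repr d).
pose r := shift (sumn p + sumn q) (repr e).
have -> : c = class_of p by rewrite class_of_repr.
have -> : d = class_of q by rewrite class_of_shift class_of_repr.
have -> : e = class_of r by rewrite class_of_shift class_of_repr.
have dpq : disjoint_perm p q by apply: disjoint_shift.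
have dpr : disjoint_perm p r by apply: disjoint_shift; apply: leq_addr.
have dqr : disjoint_perm q r by apply: disjoint_shift; apply: leq_addl.
rewrite shuffle_mul_shuffles // [RHS]shuffle_mulC shuffle_mul_shuffles //.
- by apply: perm_big; apply: shuffles3C.
- by rewrite disjoint_permC.
- by rewrite disjoint_permC.
Qed.

Lemma shuffle_mul1 : left_id shuffle_one shuffle_mul.
Proof.
move=> a; elim/malg_ind: a => [|k g h Hg Hh|c].
- exact: shuffle_mul0r.
- by rewrite shuffle_mulr Hg Hh.
rewrite /shuffle_one shuffle_mulU -(class_of_repr c) class_mulE.
  by rewrite shuffles0p big_seq1.
by apply/disjoint_permP.
Qed.

Lemma shuffle_one_neq0 : shuffle_one != 0.
Proof. by rewrite monalgU_eq0 oner_eq0. Qed.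

Local Notation A := (shuffle_algebra st_compat).

HB.instance Definition _ := GRing.Lmodule.copy A {malg rat[st_class]}.
HB.instance Definition _ := GRing.Zmodule_isComNzRing.Build A
  shuffle_mulA shuffle_mulC shuffle_mul1 shuffle_mulDl shuffle_one_neq0.

Lemma shuffle_scaleAl (k : rat) (a b : A) : k *: (a * b) = (k *: a) * b.
Proof.
have := shuffle_mull b k a 0; rewrite addr0 shuffle_mul0l addr0.
exact: esym.
Qed.

HB.instance Definition _ := GRing.Lmodule_isLalgebra.Build rat A shuffle_scaleAl.
HB.instance Definition _ := GRing.Lalgebra_isComAlgebra.Build rat A.

Definition basis_class (p : permutation) : A := << class_of p >>.

Definition homogeneous (n : nat) : {pred A} :=
  lspan [set basis_class p | p in [set p | size (word p) = n]]%classic.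

Lemma basis_class_mul p q : disjoint_perm p q ->
  basis_class p * basis_class q = \sum_(r <- shuffles p q) basis_class r.
Proof. by move=> dpq; rewrite -class_mulE // -shuffle_mulU. Qed.

End ShuffleAlgebra.

Arguments homogeneous {T st} st_compat n.

(* Q[[t]]: coefficient sequences with the Cauchy product. *)
Definition fps : Type := nat -> rat.

HB.instance Definition _ := GRing.Zmodule.copy fps (nat -> rat).

Section PowerSeries.
Implicit Types F G H : fps.

Definition fps_one : fps := fun n => (n == 0%N)%:R.

Definition fps_mul F G : fps :=
  fun n => \sum_(i < n.+1) F i * G (n - i)%N.

Let trunc F n : {poly rat} := \poly_(i < n.+1) F i.

Let coef_trunc F n i : (i <= n)%N -> (trunc F n)`_i = F i.
Proof. by move=> le_in; rewrite coef_poly ltnS le_in. Qed.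

Let fps_mulE F G n i : (i <= n)%N ->
  fps_mul F G i = (trunc F n * trunc G n)`_i.
Proof.
move=> le_in; rewrite coefM; apply: eq_bigr => j _.
rewrite !coef_trunc //; first exact: leq_trans (leq_subr _ _) le_in.
by rewrite (leq_trans _ le_in) // -ltnS.
Qed.

Let fps_mulC : commutative fps_mul.
Proof.
by move=> F G; apply/funext => n; rewrite !(fps_mulE _ _ (leqnn n)) mulrC.
Qed.

Let fps_mulA : associative fps_mul.
Proof.
move=> F G H; apply/funext => n; rewrite !(fps_mulE _ _ (leqnn n)).
transitivity (trunc F n * (trunc G n * trunc H n))`_n; last rewrite mulrA.
  rewrite coefM [in RHS]coefM; apply: eq_bigr => i _; congr (_ * _).
  by rewrite coef_trunc ?leq_subr // (fps_mulE _ _ (leq_subr i n)).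
rewrite coefM [in RHS]coefM; apply: eq_bigr => i _; congr (_ * _).
have le_in : (i <= n)%N by rewrite -ltnS.
by rewrite coef_trunc // (fps_mulE _ _ le_in).
Qed.

Let fps_mul1 : left_id fps_one fps_mul.
Proof.
move=> F; apply/funext => n; rewrite /fps_mul big_ord_recl /= mul1r subn0.
by rewrite big1 ?addr0 // => i _; rewrite /fps_one mul0r.
Qed.

Let fps_mulDl : left_distributive fps_mul +%R.
Proof.
move=> F G H; apply/funext => n; rewrite /fps_mul.
by under eq_bigr do rewrite mulrDl; rewrite big_split.
Qed.

Let fps_one_neq0 : fps_one != 0.
Proof. by apply/eqP => /(congr1 (fun F : fps => F 0%N)). Qed.

HB.instance Definition _ := GRing.Zmodule_isComNzRing.Build fps
  fps_mulA fps_mulC fps_mul1 fps_mulDl fps_one_neq0.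

Fixpoint fps_inv_seq F (n : nat) : seq rat :=
  if n is m.+1 then
    let s := fps_inv_seq F m in
    rcons s (- (F 0%N)^-1 * \sum_(i < m.+1) F i.+1 * s`_(m - i))
  else [:: (F 0%N)^-1].

Definition fps_unit : {pred fps} := fun F => F 0%N != 0.

(* The usual recursion for the coefficients of 1/F when F has a nonzero
   constant term. *)
Definition fps_inv F : fps :=
  if F \in fps_unit then fun n => (fps_inv_seq F n)`_n else F.

Let size_fps_inv_seq F n : size (fps_inv_seq F n) = n.+1.
Proof. by elim: n => //= n IHn; rewrite size_rcons IHn. Qed.

Let nth_fps_inv_seq F n i : (i <= n)%N ->
  (fps_inv_seq F n)`_i = (fps_inv_seq F i)`_i.
Proof.
elim: n => [|n IHn]; first by rewrite leqn0 => /eqP->.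
rewrite leq_eqVlt => /orP[/eqP->//|]; rewrite ltnS => le_in.
by rewrite /= nth_rcons size_fps_inv_seq ltnS le_in IHn.
Qed.

Let fps_mulV : {in fps_unit, left_inverse 1 fps_inv *%R}.
Proof.
move=> F uF; rewrite mulrC; apply/funext => n.
rewrite -[LHS]/(fps_mul F (fps_inv F) n) /fps_inv uF /fps_mul big_ord_recl /= subn0.
case: n => [|n] /=; first by rewrite big_ord0 addr0 mulfV.
rewrite nth_rcons size_fps_inv_seq ltnn eqxx mulrA mulrN mulfV // mulN1r.
apply/eqP; rewrite addrC subr_eq0; apply/eqP/eq_bigr => i _.
by rewrite /bump /= add1n subSS (nth_fps_inv_seq _ (leq_subr i n)).
Qed.

Let fps_unitP F G : G * F = 1 -> fps_unit F.
Proof.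
move=> /(congr1 (fun H : fps => H 0%N)).
rewrite -[LHS]/(fps_mul G F 0) /fps_mul big_ord1 subn0 => GF.
by apply: contra_eq_neq GF => ->; rewrite mulr0.
Qed.

Let fps_inv_out : {in [predC fps_unit], fps_inv =1 id}.
Proof. by move=> F /negbTE uF; rewrite /fps_inv uF. Qed.

HB.instance Definition _ := GRing.ComNzRing_hasMulInverse.Build fps
  fps_mulV fps_unitP fps_inv_out.

End PowerSeries.

Definition fps_t : fps := fun n => (n == 1%N)%:R.

(* Q[[t*]]: the same series with the Hadamard product, which is the pointwise
   product of nat -> rat; its unit is 1/(1-t). *)
Definition hfps : Type := nat -> rat.

HB.instance Definition _ := GRing.ComNzRing.copy hfps (nat -> rat).

Definition had (F : fps) : hfps := F.

Lemma hadM F G n : (had F * had G) n = F n * G n.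
Proof. by []. Qed.

(* Q[[t*]][x], as a Q-algebra. *)
Definition hpoly : Type := {poly hfps}.

HB.instance Definition _ := GRing.ComNzRing.copy hpoly {poly hfps}.

Section HadamardPoly.
Implicit Types (c d : rat) (p q : hpoly).

Definition hconst c : hfps := fun=> c.

Definition hpoly_scale c p : hpoly := hconst c *: (p : {poly hfps}).

Let hpoly_scaleA c d p :
  hpoly_scale c (hpoly_scale d p) = hpoly_scale (c * d) p.
Proof. by rewrite /hpoly_scale scalerA. Qed.

Let hpoly_scale1 : left_id 1 hpoly_scale.
Proof. by move=> p; rewrite /hpoly_scale scale1r. Qed.

Let hpoly_scaleDr : right_distributive hpoly_scale +%R.
Proof. by move=> c p q; rewrite /hpoly_scale scalerDr. Qed.

Let hpoly_scaleDl p : {morph hpoly_scale^~ p : c d / c + d}.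
Proof. by move=> c d; rewrite /hpoly_scale -scalerDl. Qed.

HB.instance Definition _ := GRing.Zmodule_isLmodule.Build rat hpoly
  hpoly_scaleA hpoly_scale1 hpoly_scaleDr hpoly_scaleDl.

Let hpoly_scaleAl c p q : c *: (p * q) = (c *: p) * q.
Proof. by rewrite [LHS]scalerAl. Qed.

HB.instance Definition _ := GRing.Lmodule_isLalgebra.Build rat hpoly hpoly_scaleAl.
HB.instance Definition _ := GRing.Lalgebra_isComAlgebra.Build rat hpoly.

Lemma hpoly_scaleE c p i n : (c *: p)`_i n = c * p`_i n.
Proof. by rewrite -[c *: p]/(hpoly_scale c p) /hpoly_scale coefZ. Qed.

End HadamardPoly.

Definition hmonom (F : fps) (n : nat) : hpoly := (had F)%:P * 'X^n.

Definition udr_series (n j : nat) : fps :=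
  2 ^+ (j - 1) * fps_t ^+ j * (1 + fps_t ^+ 2) ^+ (n - j) /
    ((1 - fps_t) ^+ 2 * (1 - fps_t ^+ 2) ^+ (n - 1)).

Definition udr_image (p : permutation) : hpoly :=
  if size p == 0%N then hmonom (1 / (1 - fps_t)) 0
  else hmonom (udr_series (size p) (udr p)) (size p).

Definition udr_span : {pred hpoly} :=
  lspan [set v : hpoly |
           v = hmonom (1 / (1 - fps_t)) 0 \/
           exists n j : nat, [/\ (1 <= n)%N, (1 <= j <= n)%N
                               & v = hmonom (udr_series n j) n]]%classic.

(* Main.v *)
(** For a letter sequence w let f_k(w) be the number of ways of cutting w into k
    possibly empty blocks that are alternately increasing and decreasing, the
    first one increasing. A cut of p together with a cut of q merges blockwise
    into a cut of exactly one shuffle of p and q, so f_k(p) f_k(q) is the sum of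
    f_k over the shuffles of p and q. Removing the first letter of w gives a
    linear recursion for the series of the f_k(w) t^k, with a factor
    (1 + t^2)/(1 - t^2) if the direction is kept and 2t/(1 - t^2) if it changes;
    hence this series is the one attached to the length and the number of
    up-down runs of w. For a fixed length n the series for j = 1, ..., n start in
    degree j, so they are linearly independent, and the multiplicativity of f_k
    yields both shuffle compatibility and the isomorphism. *)
Require Import Defs.
From HB Require Import structures.
From mathcomp Require Import all_boot all_order all_algebra.
From mathcomp Require Import zify ring.
From mathcomp Require Import finmap boolp classical_sets.
From mathcomp.multinomials Require Import monalg.

Set Implicit Arguments.
Unset Strict Implicit.
Unset Printing Implicit Defensive.

Import GRing.Theory.
Local Open Scope ring_scope.

(** * Shuffles of words *)

Section Words.
Local Open Scope nat_scope.

Section Shuffle.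
Variable T : eqType.
Implicit Types (u v w : seq T) (G : seq T -> seq T -> nat).

Fixpoint splits w : seq (seq T * seq T) :=
  ([::], w) ::
  if w is a :: w' then [seq (a :: s.1, s.2) | s <- splits w'] else [::].

(** Shuffles are built by choosing the first letter, so that sums over them unfold by induction; the
    inner fixpoint covers the calls in which only the second word shrinks. *)
Fixpoint word_shuffles u : seq T -> seq (seq T) :=
  if u is a :: u' then
    fix shuffle_u v :=
      if v is b :: v' then
        [seq a :: w | w <- word_shuffles u' v] ++ [seq b :: w | w <- shuffle_u v']
      else [:: u]
  else fun v => [:: v].

Lemma word_shuffles_cons a u b v :
  word_shuffles (a :: u) (b :: v) =
    [seq a :: w | w <- word_shuffles u (b :: v)] ++
    [seq b :: w | w <- word_shuffles (a :: u) v].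
Proof. by []. Qed.

Lemma word_shuffles0 u : word_shuffles u [::] = [:: u].
Proof. by case: u. Qed.

Lemma sum_splits_cons (F : seq T * seq T -> nat) a w :
  \sum_(s <- splits (a :: w)) F s =
    F ([::], a :: w) + \sum_(s <- splits w) F (a :: s.1, s.2).
Proof. by rewrite /= big_cons big_map. Qed.

Lemma sum_shuffles_cons (F : seq T -> nat) a u b v :
  \sum_(w <- word_shuffles (a :: u) (b :: v)) F w =
    \sum_(w <- word_shuffles u (b :: v)) F (a :: w) +
    \sum_(w <- word_shuffles (a :: u) v) F (b :: w).
Proof. by rewrite word_shuffles_cons big_cat !big_map. Qed.

Arguments splits : simpl never.
Arguments word_shuffles : simpl never.

(** Cutting a shuffle in two cuts [u] and [v], and shuffles the prefixes and the suffixes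
    separately. [G] is arbitrary because the induction absorbs the first letter of the shuffle into
    it. *)
Lemma sum_splits_shuffles G u v :
  \sum_(w <- word_shuffles u v) \sum_(s <- splits w) G s.1 s.2 =
  \sum_(s <- splits u) \sum_(r <- splits v)
    \sum_(x <- word_shuffles s.1 r.1) \sum_(y <- word_shuffles s.2 r.2) G x y.
Proof.
have sum0l (F : seq T -> nat) v' : \sum_(w <- word_shuffles [::] v') F w = F v'.
  by rewrite /word_shuffles big_seq1.
have sum0r (F : seq T -> nat) v' : \sum_(w <- word_shuffles v' [::]) F w = F v'.
  by rewrite word_shuffles0 big_seq1.
elim: u v G => [|a u IHu] v G.
  rewrite sum0l big_seq1; apply: eq_bigr => r _.
  by rewrite !sum0l.
elim: v G => [|b v IHv] G.
  rewrite sum0r; apply: eq_bigr => s _.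
  by rewrite big_seq1 !sum0r.
rewrite sum_shuffles_cons.
under eq_bigr do rewrite sum_splits_cons.
under [X in _ + X = _]eq_bigr do rewrite sum_splits_cons.
(* The cuts with empty prefix recombine into one sum over the shuffles of the whole words. *)
rewrite !big_split /= addnACA -(sum_shuffles_cons (G [::])).
rewrite (IHu (b :: v) (fun x => G (a :: x))) (IHv (fun x => G (b :: x))).
rewrite !sum_splits_cons /= sum0l -!addnA; congr (_ + _).
have -> : \sum_(r <- splits v) \sum_(x <- word_shuffles [::] r.1)
    \sum_(y <- word_shuffles (a :: u) r.2) G (b :: x) y =
  \sum_(r <- splits v) \sum_(x <- word_shuffles [::] (b :: r.1))
    \sum_(y <- word_shuffles (a :: u) r.2) G x y.
  by apply: eq_bigr => r _; rewrite !sum0l.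
rewrite addnCA; congr (_ + _); rewrite -big_split; apply: eq_bigr => s _.
rewrite !sum_splits_cons /= !sum0r -addnA; congr (_ + _); rewrite -big_split.
by apply: eq_bigr => r _; rewrite sum_shuffles_cons.
Qed.

Lemma perm_word_shuffles u v w : w \in word_shuffles u v -> perm_eq w (u ++ v).
Proof.
elim: u v w => [|a u IHu] v w; first by rewrite inE => /eqP->.
elim: v w => [|b v IHv] w; first by rewrite inE => /eqP->; rewrite cats0.
rewrite word_shuffles_cons mem_cat => /orP[] /mapP[w' w'in ->].
  by rewrite /= perm_cons IHu.
rewrite -cat1s perm_sym perm_catC /= perm_cons perm_sym.
by rewrite (perm_trans (IHv _ w'in)) // perm_catC.
Qed.

Lemma word_shuffles_subseq u v w :
  w \in word_shuffles u v -> subseq u w && subseq v w.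
Proof.
elim: u v w => [|a u IHu] v w; first by rewrite inE => /eqP->; rewrite sub0seq subseq_refl.
elim: v w => [|b v IHv] w; first by rewrite inE => /eqP->; rewrite sub0seq subseq_refl.
rewrite word_shuffles_cons mem_cat => /orP[] /mapP[w' w'in ->].
  have /andP[h1 h2] := IHu _ _ w'in.
  by rewrite (subseq_trans h2) ?subseq_cons // andbT /= eqxx.
have /andP[h1 h2] := IHv _ w'in.
by rewrite (subseq_trans h1) ?subseq_cons //= eqxx.
Qed.

Lemma word_shuffles_uniq u v : uniq (u ++ v) -> uniq (word_shuffles u v).
Proof.
elim: u v => [|a u IHu] // v; elim: v => [|b v IHv] // uv.
rewrite word_shuffles_cons cat_uniq !map_inj_uniq; try by move=> ? ? [].
rewrite IHu; last by case/andP: uv.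
rewrite IHv; last first.
  exact: subseq_uniq (cat_subseq (subseq_refl _) (subseq_cons _ _)) uv.
rewrite andbT /=; apply/hasPn => _ /mapP[x _ ->]; apply/mapP => -[y _ [ba]].
by move: uv; rewrite ba /= mem_cat inE eqxx orbT.
Qed.

(** The first letter of [w] must be the head of [u] or of [v]: if it lay further inside one of them,
    the subsequence condition would make it reappear in the tail of [w]. *)
Lemma mem_word_shuffles u v w : uniq w -> perm_eq w (u ++ v) ->
  subseq u w -> subseq v w -> w \in word_shuffles u v.
Proof.
elim: w u v => [|c w IHw] u v.
  by rewrite perm_sym => _ /perm_nilP; case: u => //= ->; rewrite inE.
move=> uw pw su sv.
case: u pw su => [|a u] pw su.
  have := perm_size pw; rewrite /= => /esym/eqP.
  by rewrite (size_subseq_leqif sv).2 => /eqP->; rewrite inE.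
case: v pw sv => [|b v] pw sv.
  have := perm_size pw; rewrite cats0 => /esym/eqP.
  by rewrite (size_subseq_leqif su).2 => /eqP->; rewrite word_shuffles0 inE.
case/andP: uw => cw uw.
have uuv : uniq ((a :: u) ++ b :: v) by rewrite -(perm_uniq pw) /= cw.
have cuv : c \in (a :: u) ++ b :: v by rewrite -(perm_mem pw) mem_head.
have ab : a != b.
  by apply: contraTneq uuv => ->; rewrite /= mem_cat mem_head orbT.
rewrite word_shuffles_cons mem_cat.
have [ac|nac] := eqVneq a c.
  subst c; apply/orP; left; apply: map_f; apply: IHw => //.
  - by rewrite -(perm_cons a).
  - by move: su; rewrite /= eqxx.
  - by move: sv; rewrite /= eq_sym (negbTE ab).
have [bc|nbc] := eqVneq b c.
  subst c; apply/orP; right; apply: map_f; apply: IHw => //.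
  - rewrite -(perm_cons b) (perm_trans pw) // -(cat1s b) perm_catCA; exact: perm_refl.
  - by move: su; rewrite /= (negbTE ab).
  - by move: sv; rewrite /= eqxx.
move: su sv cuv; rewrite /= (negbTE nac) (negbTE nbc) inE mem_cat inE.
rewrite (eq_sym c) (negbTE nac) (eq_sym c) (negbTE nbc) /= => su sv.
case/orP => h; case/negP: cw.
  by apply: (mem_subseq su); rewrite inE h orbT.
by apply: (mem_subseq sv); rewrite inE h orbT.
Qed.

End Shuffle.

Lemma perm_word_shuffles_shuffles (p q : permutation) : disjoint_perm p q ->
  perm_eq [seq word r | r <- shuffles p q] (word_shuffles (word p) (word q)).
Proof.
move=> dpq; have upq : uniq (word p ++ word q) by rewrite uniq_cat_disjoint.
apply: uniq_perm; rewrite ?word_shuffles_uniq ?(map_inj_uniq val_inj) ?shuffles_uniq //.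
move=> w; apply/mapP/idP => [[r rpq ->]|wpq].
  have /andP[pr qr] := shuffles_subseq rpq.
  by apply: mem_word_shuffles; rewrite ?uniq_word ?(shuffles_perm rpq).
have pw := perm_word_shuffles wpq.
have wP : uniq w && all (leq 1) w.
  rewrite (perm_uniq pw) upq; apply/allP => x; rewrite (perm_mem pw) mem_cat.
  by case/orP => /pos_word.
exists (Permutation wP) => //.
rewrite mem_shuffles //= (perm_size pw) size_cat eqxx.
exact: word_shuffles_subseq.
Qed.

(** * Cuts into monotone blocks *)

Definition dir_lt (b : bool) : rel nat := if b then ltn else gtn.

Lemma dir_lt_trans b : transitive (dir_lt b).
Proof.
by case: b => y x z /=; [exact: ltn_trans | move=> h1 h2; apply: ltn_trans h1].
Qed.

Lemma dir_lt_asym b x y : x != y -> dir_lt b y x = ~~ dir_lt b x y.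
Proof. by rewrite /dir_lt; case: b => /=; case: ltngtP. Qed.

(** Two words sorted in direction [b] have exactly one sorted shuffle, their merge, and a sorted
    shuffle has only sorted subsequences. Of the two possible first letters, only the one that comes
    first in direction [b] can contribute. *)
Lemma sum_sorted_shuffles b u v : uniq (u ++ v) ->
  \sum_(w <- word_shuffles u v) sorted (dir_lt b) w =
    sorted (dir_lt b) u * sorted (dir_lt b) v.
Proof.
elim: u v => [|x u IHu] v; first by rewrite /= big_seq1 mul1n.
elim: v => [|y v IHv] uv; first by rewrite word_shuffles0 big_seq1 muln1.
rewrite sum_shuffles_cons.
have ux : uniq (u ++ y :: v) by case/andP: uv.
have uy : uniq ((x :: u) ++ v).
  exact: subseq_uniq (cat_subseq (subseq_refl _) (subseq_cons _ _)) uv.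
have xy : x != y.
  by apply: contraTneq uv => ->; rewrite /= mem_cat mem_head orbT.
have sumE z s t : \sum_(w <- word_shuffles s t) sorted (dir_lt b) (z :: w) =
    all (dir_lt b z) (s ++ t) *
    \sum_(w <- word_shuffles s t) sorted (dir_lt b) w.
  rewrite big_distrr /=; apply: eq_big_seq => w /perm_word_shuffles pw.
  by rewrite path_sortedE ?(perm_all _ pw) ?mulnb //; apply: dir_lt_trans.
rewrite !sumE (IHu _ ux) (IHv uy).
rewrite /= (path_sortedE (@dir_lt_trans b)) (path_sortedE (@dir_lt_trans b)).
(* By transitivity, the head that comes first precedes every letter that the other head precedes;
   what remains is a Boolean identity. *)
have hu : ~~ dir_lt b x y -> all (dir_lt b x) u ==> all (dir_lt b y) u.
  move=> yx; apply/implyP => /allP xu; apply/allP => z /xu; apply: dir_lt_trans.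
  by rewrite dir_lt_asym.
have hv : dir_lt b x y -> all (dir_lt b y) v ==> all (dir_lt b x) v.
  by move=> lxy; apply/implyP => /allP yv; apply/allP => z /yv; apply: dir_lt_trans.
rewrite !all_cat /= (dir_lt_asym _ xy); move: hu hv.
case: (dir_lt b x y) => /= [_ /(_ isT) | /(_ isT) + _];
  by do 3![case: (all _ _)]; case: (sorted _ u); case: (sorted _ v).
Qed.

(* f_k(w) for b = true; for b = false the first block is decreasing. *)
Fixpoint block_count (b : bool) (k : nat) (w : seq nat) : nat :=
  if k is k'.+1 then
    \sum_(s <- splits w) sorted (dir_lt b) s.1 * block_count (~~ b) k' s.2
  else w == [::].

Lemma splits_cat (T : eqType) (w : seq T) s : s \in splits w -> s.1 ++ s.2 = w.
Proof.
elim: w s => [|a w IHw] s; first by rewrite inE => /eqP->.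
by rewrite inE => /orP[/eqP->|/mapP[r /IHw <- ->]].
Qed.

(** Induction on the number of blocks: [sum_splits_shuffles] detaches the first block, which is
    handled by [sum_sorted_shuffles], and the rest falls under the induction hypothesis. *)
Lemma sum_block_count_shuffles b k u v : uniq (u ++ v) ->
  \sum_(w <- word_shuffles u v) block_count b k w =
    block_count b k u * block_count b k v.
Proof.
elim: k b u v => [|k IHk] b u v uv /=.
  case: u uv => [|x u] uv; first by rewrite big_seq1 mul1n.
  rewrite mul0n big1_seq // => w /andP[_ /perm_word_shuffles /perm_size].
  by case: w.
rewrite (sum_splits_shuffles
  (fun x y => sorted (dir_lt b) x * block_count (~~ b) k y)).
rewrite big_distrl /=; apply: eq_big_seq => s /splits_cat su.
rewrite big_distrr /=; apply: eq_big_seq => r /splits_cat rv.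
have [u1 u2] : uniq (s.1 ++ r.1) /\ uniq (s.2 ++ r.2).
  by split; apply: subseq_uniq uv; rewrite -su -rv; apply: cat_subseq;
    rewrite ?prefix_subseq ?suffix_subseq.
under eq_bigr do rewrite -big_distrr /= IHk //.
by rewrite -big_distrl /= sum_sorted_shuffles // mulnACA.
Qed.

End Words.

(** * Up-down runs *)

Section Runs.
Local Open Scope nat_scope.
Implicit Types (b : bool) (w : seq nat).

Lemma block_count_nil b k : block_count b k [::] = 1.
Proof. by elim: k b => //= k IHk b; rewrite big_seq1 IHk. Qed.

Lemma block_count1 b k x : block_count b k [:: x] = k.
Proof.
elim: k b => //= k IHk b.
by rewrite sum_splits_cons big_seq1 /= IHk block_count_nil mul1n addn1.
Qed.

(** The first block is empty or contains [x]. If [y] may follow [x] in it, deleting [x] leaves an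
    arbitrary cut of [y :: w]; if not, the block is [x] alone. *)
Lemma block_count_cons2 b k x y w :
  block_count b k.+1 (x :: y :: w) =
    block_count (~~ b) k (x :: y :: w) +
    (if dir_lt b x y then block_count b k.+1 (y :: w)
     else block_count (~~ b) k (y :: w)).
Proof.
rewrite /= !sum_splits_cons /= !mul1n; congr (_ + _).
by case: (dir_lt b x y) => //=; rewrite big1 ?addn0.
Qed.

(* For b = true this is num_udr, see num_udrE; the recursion removes the first
   letter, which changes the direction b that the next run is compared to. *)
Fixpoint run_count b w : nat :=
  if w is x :: w' then
    if w' is y :: _ then (b != (x < y)) + run_count (x < y) w' else 1
  else 0.

Lemma run_count_cons2 b x y w :
  run_count b (x :: y :: w) = (b != (x < y)) + run_count (x < y) (y :: w).
Proof. by []. Qed.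

Lemma run_count_bounds b x w : 1 <= run_count b (x :: w) <= (size w).+1.
Proof.
elim: w b x => [|y w IHw] b x //; rewrite run_count_cons2.
by rewrite [size _]/=; have := IHw (x < y) y; case: (b != _); lia.
Qed.

(** * Biruns and changes of direction *)

Definition ascent w i : bool := nth 0 w i < nth 0 w i.+1.

(** Each change of direction adds a run, with [b] as fictitious direction before the first letter;
    the extra one comes from the one-letter base case. *)
Lemma run_count_ascents b x w :
  run_count b (x :: w) =
    (count (fun i => (if i is j.+1 then ascent (x :: w) j else b) !=
                     ascent (x :: w) i) (iota 0 (size w))).+1.
Proof.
elim: w b x => [|y w IHw] b x //; rewrite run_count_cons2 IHw addnS /=.
rewrite -[1]/(1 + 0) iotaDl count_map; congr (_ + _).+1.
by apply: eq_count => -[|i].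
Qed.

Lemma nth_factor w i j k : k < j - i -> j <= size w ->
  nth 0 (factor w (i, j)) k = nth 0 w (i + k).
Proof. by move=> kij jw; rewrite nth_drop nth_take // -ltn_subRL. Qed.

Lemma size_factor w i j : j <= size w -> size (factor w (i, j)) = j - i.
Proof. by move=> jw; rewrite size_drop size_take_min (minn_idPl jw). Qed.

Lemma sorted_factor b w i j : uniq w -> j <= size w ->
  sorted (dir_lt b) (factor w (i, j)) <->
  (forall k, i <= k -> k.+1 < j -> ascent w k = b).
Proof.
move=> uw jw.
have dirE k : k.+1 < j -> dir_lt b (nth 0 w k) (nth 0 w k.+1) = (ascent w k == b).
  move=> kj; have kw := leq_trans kj jw.
  have : nth 0 w k != nth 0 w k.+1 by rewrite nth_uniq // ?neq_ltn ?ltnSn // ltnW.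
  by rewrite /ascent /dir_lt; case: b => /=; case: ltngtP.
split=> [/(sortedP 0) H k ik kj|H].
  suff: ascent w k == b by move/eqP.
  rewrite -dirE //.
  have := H (k - i); rewrite size_factor // !nth_factor //; try by lia.
  by rewrite (_ : i + (k - i).+1 = k.+1) 1?(_ : i + (k - i) = k); [apply; lia|lia..].
apply/(sortedP 0) => k; rewrite size_factor // => kij.
rewrite !nth_factor //; try by lia.
by rewrite addnS dirE; [apply/eqP/H; lia|lia].
Qed.

(** If neighbouring steps inside the factor agree, they all agree with the first one, which fixes
    the direction; factors of at most two letters leave nothing to check. *)
Lemma monotone_factor w i j : uniq w -> j <= size w ->
  monotone (factor w (i, j)) <->
  (forall k, i <= k -> k.+2 < j -> ascent w k = ascent w k.+1).
Proof.
move=> uw jw; split.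
  have H b k : sorted (dir_lt b) (factor w (i, j)) -> i <= k -> k.+2 < j ->
      ascent w k = ascent w k.+1.
    by move=> /sorted_factor => /(_ uw jw) H ik kj; rewrite !H; lia.
  by case/orP => [/(H true)|/(H false)] h k; apply: h.
move=> H; suff: sorted (dir_lt (ascent w i)) (factor w (i, j)).
  by rewrite /monotone; case: (ascent w i) => /= ->; rewrite ?orbT.
apply/sorted_factor => // k ik; rewrite -(subnKC ik).
elim: (k - i) => [|m IHm] mj; first by rewrite addn0.
by rewrite addnS -H; [apply: IHm; lia|lia|lia].
Qed.

Lemma mem_intervals n i j : ((i, j) \in intervals n) = (i < j <= n).
Proof.
rewrite mem_filter [(i, j).1 < _]/=; case: ltnP => // ij; rewrite andTb. apply/allpairsPdep/idP.
  by case=> i' [j' [_ + [_ ->]]]; rewrite mem_iota; lia.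
by move=> jn; exists i, j; rewrite !mem_iota; split=> //; lia.
Qed.

Lemma intervals_uniq n : uniq (intervals n).
Proof.
rewrite filter_uniq // allpairs_uniq ?iota_uniq //.
by move=> [? ?] [? ?] _ _ /= [-> ->].
Qed.

Lemma is_birunP w i j : reflect
  (monotone (factor w (i, j)) /\
   forall k l, k <= i -> j <= l -> k < l <= size w -> monotone (factor w (k, l)) ->
     k = i /\ l = j)
  (is_birun w (i, j)).
Proof.
apply: (iffP andP) => -[mij H]; split=> //.
  move=> k l ki jl; rewrite -mem_intervals => /(allP H) /=.
  by rewrite ki jl /= => /implyP h /h /eqP[].
apply/allP => -[k l]; rewrite mem_intervals /= => kl.
by apply/implyP => /and3P[ki jl mkl]; have [-> ->] := H k l ki jl kl mkl.
Qed.

Lemma mem_biruns w i j :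
  ((i, j) \in biruns w) = is_birun w (i, j) && (i < j <= size w).
Proof. by rewrite mem_filter mem_intervals. Qed.

(** The places where a birun starts; position 0 always counts, whereas [run_count] compares it with
    [b]. *)
Definition turns_at w i : bool := (i == 0) || (ascent w i.-1 != ascent w i).

(** Biruns with a common start are nested, hence equal by maximality; conversely, the longest
    monotone factor that starts at a turn is a birun. *)
Lemma perm_biruns_starts w : uniq w -> 1 < size w ->
  perm_eq [seq ij.1 | ij <- biruns w] [seq i <- iota 0 (size w).-1 | turns_at w i].
Proof.
move=> uw w1; apply: uniq_perm.
- rewrite map_inj_in_uniq ?(filter_uniq _ (intervals_uniq _)) //.
  move=> [i j] [i' j']; rewrite !mem_biruns.
  case/andP => /is_birunP[mj Hj] ij /andP[/is_birunP[mj' Hj'] ij'] /= ii'.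
  subst i'; case: (leqP j j') => jj'.
    by have [_ ->] := Hj i j' (leqnn _) jj' ij' mj'.
  by have [_ ->] := Hj' i j (leqnn _) (ltnW jj') ij mj.
- by rewrite filter_uniq ?iota_uniq.
move=> i; rewrite mem_filter mem_iota; apply/mapP/andP.
  case=> -[i' j]; rewrite mem_biruns => /andP[/is_birunP[mij H] ij] /= ->.
  move: i' {i} mij H ij => i /monotone_factor mij H ij.
  have jw : j <= size w by lia.
  have {}mij := mij uw jw.
  (* Maximality forbids adding the letter on the left, which would be possible for a single letter
     or after a step in the same direction. *)
  have noext : 0 < i -> (j = i.+1 \/ ascent w i.-1 = ascent w i) -> False.
    move=> i0 ext; have [] := H i.-1 j; try by lia.
    apply/monotone_factor => // k ik kj.
    case: (ltnP i.-1 k) => ik'; first by apply: mij; lia.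
    have -> : k = i.-1 by lia.
    by case: ext => [|->]; [lia|rewrite prednK].
  split; last first.
    rewrite /= add0n; case: (ltnP i (size w).-1) => // ni.
    by exfalso; apply: noext; [lia|left; lia].
  rewrite /turns_at; case: eqP => //= /eqP; rewrite -lt0n => i0.
  by apply/eqP => e; apply: noext => //; right.
rewrite add0n /= => -[ti iw].
pose P j := (i < j <= size w) && monotone (factor w (i, j)).
have Pex : exists j, P j.
  (* Two letters are always monotone, and [i] is not the last position. *)
  exists i.+2; apply/andP; split; first by lia.
  by apply/monotone_factor => //; [lia|move=> k; lia].
have Pub j : P j -> j <= size w by case/andP; lia.
case: (ex_maxnP Pex Pub) => j /andP[ij mij] jmax.
have i2j : i.+2 <= j.
  apply: jmax; apply/andP; split; first by lia.
  by apply/monotone_factor => //; [lia|move=> k; lia].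
exists (i, j) => //; rewrite mem_biruns ij andbT.
apply/is_birunP; split=> // k l ki jl kl /monotone_factor mkl.
have {}mkl := mkl uw (proj2 (andP kl)).
have lj : l <= j.
  apply: jmax; apply/andP; split; first by lia.
  apply/monotone_factor => // [|m im ml]; first by lia.
  by apply: mkl; lia.
split; last by lia.
(* A factor starting before [i] contains both steps that meet at [i], and these differ in direction
   at a turn. *)
case: (ltnP k i) => [lki|]; last by lia.
case/orP: ti => [|/eqP[]]; first by lia.
by rewrite mkl ?prednK //; lia.
Qed.

(** Position 0 always starts a birun, which is the extra one in [run_count_ascents]; the initial
    one-letter run is the change from the fictitious ascent [true] to a first descent. *)
Lemma num_udrE w : uniq w -> num_udr w = run_count true w.
Proof.
case: w => [|x [|y w]] // uw.
rewrite /num_udr -(size_map fst) (perm_size (perm_biruns_starts uw _)) //.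
rewrite run_count_ascents size_filter /=.
rewrite (_ : (y < x) = (true != ascent [:: x, y & w] 0)); last first.
  rewrite /ascent /=; move: uw; rewrite /= inE negb_or => /andP[/andP[/eqP xy _] _].
  by lia.
rewrite addnC addnS; congr (_ + _).+1; apply: eq_in_count => i.
by rewrite mem_iota; case: i => //; lia.
Qed.

End Runs.

(** * Power series *)

Section Series.
Implicit Types (F G : fps) (b : bool) (w : seq nat).

Lemma fps_coef0M F G : (F * G) 0%N = F 0%N * G 0%N.
Proof.
by rewrite -[LHS]/(fps_mul F G 0) /fps_mul big_ord1 subn0.
Qed.

Lemma fps_coef0X F m : (F ^+ m) 0%N = F 0%N ^+ m.
Proof. by elim: m => // m IHm; rewrite !exprS fps_coef0M IHm. Qed.

Lemma fps_coefD F G m : (F + G) m = F m + G m.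
Proof. by []. Qed.

Lemma fps_coefN F m : (- F) m = - F m.
Proof. by []. Qed.

Lemma fps_t_mul0 F : (fps_t * F) 0%N = 0.
Proof. by rewrite fps_coef0M mul0r. Qed.

Lemma fps_t_mulS F m : (fps_t * F) m.+1 = F m.
Proof.
rewrite -[LHS]/(fps_mul fps_t F m.+1) /fps_mul big_ord_recl mul0r add0r.
rewrite big_ord_recl mul1r big1 ?addr0 ?subSS ?subn0 // => i _.
by rewrite mul0r.
Qed.

Lemma fps_t_exp_mul j F m :
  (fps_t ^+ j * F) m = if (m < j)%N then 0 else F (m - j)%N.
Proof.
elim: j m => [|j IHj] m; first by rewrite mul1r subn0.
rewrite exprS -mulrA; case: m => [|m]; first by rewrite fps_t_mul0.
by rewrite fps_t_mulS IHj ltnS subSS.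
Qed.

Lemma fps_unitE F : (F \is a GRing.unit) = (F 0%N != 0).
Proof. by rewrite -[LHS]/(F \in fps_unit). Qed.

Lemma fps_coef01 : (1 : fps) 0%N = 1.
Proof. by []. Qed.

Lemma fps_coef0t : fps_t 0%N = 0.
Proof. by []. Qed.

Definition fps_coef0E :=
  (fps_coefD, fps_coefN, fps_coef0M, fps_coef0X, fps_coef01, fps_coef0t).

Lemma unit_1Bt : 1 - fps_t \is a GRing.unit.
Proof. by rewrite fps_unitE !fps_coef0E subr0 oner_neq0. Qed.

Lemma unit_1Bt2 : 1 - fps_t ^+ 2 \is a GRing.unit.
Proof. by rewrite fps_unitE !fps_coef0E expr0n subr0 oner_neq0. Qed.

Lemma one_sub_t_mul_ones : (1 - fps_t) * (fun=> 1) = 1 :> fps.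
Proof.
apply/funext => m; rewrite mulrBl mul1r fps_coefD fps_coefN.
by case: m => [|m]; rewrite ?fps_t_mul0 ?fps_t_mulS ?subr0 ?subrr.
Qed.

Lemma inv_1Bt : 1 / (1 - fps_t) = (fun=> 1) :> fps.
Proof.
by apply: (mulrI unit_1Bt); rewrite div1r mulrV ?unit_1Bt ?one_sub_t_mul_ones.
Qed.

Definition block_series b w : fps := fun k => (block_count b k w)%:R.

(** The letter lies in any one of the [k] blocks, and [t/(1-t)^2] is the series with coefficients
    [k]. *)
Lemma block_series1 b x : (1 - fps_t) ^+ 2 * block_series b [:: x] = fps_t.
Proof.
pose ones : fps := fun=> 1.
have E : (1 - fps_t) * block_series b [:: x] = fps_t * ones.
  apply/funext => m; rewrite mulrBl mul1r fps_coefD fps_coefN.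
  case: m => [|m]; rewrite ?fps_t_mul0 ?fps_t_mulS /block_series !block_count1 //.
  by rewrite -natrB // subSnn.
by rewrite expr2 -mulrA E mulrCA one_sub_t_mul_ones mulr1.
Qed.

Lemma block_series_cons2 b x y w :
  block_series b (x :: y :: w) =
    fps_t * block_series (~~ b) (x :: y :: w) +
    (if dir_lt b x y then block_series b (y :: w)
     else fps_t * block_series (~~ b) (y :: w)).
Proof.
apply/funext => -[|m]; rewrite fps_coefD ?fps_t_mul0 ?fps_t_mulS.
  by case: ifP; rewrite ?fps_t_mul0.
rewrite /block_series block_count_cons2 natrD; congr (_ + _).
by case: ifP; rewrite ?fps_t_mulS.
Qed.

(** The recursions [block_series_cons2] for [b] and for [~~ b] form a linear system; eliminating the
    series with the other initial direction produces [1 - t^2]. *)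
Lemma block_series_step b x y w : x != y ->
  (1 - fps_t ^+ 2) * block_series b (x :: y :: w) =
    (if b == (x < y)%N then 1 + fps_t ^+ 2 else 2 * fps_t) *
    block_series (x < y)%N (y :: w).
Proof.
move=> xy; have H d := block_series_cons2 d x y w.
have dE d : dir_lt d x y = (d == (x < y)%N).
  by rewrite /dir_lt; case: d => /=; case: ltngtP xy.
have := H b; have := H (~~ b); rewrite !dE negbK.
have [->|bd] := eqVneq b (x < y)%N.
  rewrite (_ : (~~ (x < y)%N == (x < y)%N) = false); last by case: (x < y)%N.
  by move=> BE AE; rewrite mulrBl mul1r {1}AE BE; ring.
have -> : ~~ b = (x < y)%N by case: b bd; case: (x < y)%N.
rewrite eqxx => BE AE.
by rewrite mulrBl mul1r {1}AE BE; ring.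
Qed.

Lemma block_series_run_count b w : (0 < size w)%N -> uniq w ->
  block_series b w = udr_series (size w) (run_count b w).
Proof.
(* [d m] is the denominator for [m.+1] letters; once it is cleared, the induction only multiplies
   numerators. *)
case: w => // x w _ uw; pose d m := (1 - fps_t) ^+ 2 * (1 - fps_t ^+ 2) ^+ m.
have ud m : d m \is a GRing.unit.
  by rewrite unitrM !unitrX ?unit_1Bt ?unit_1Bt2.
suff E : d (size w) * block_series b (x :: w) =
   2 ^+ (run_count b (x :: w) - 1) * fps_t ^+ run_count b (x :: w) *
   (1 + fps_t ^+ 2) ^+ (size (x :: w) - run_count b (x :: w)).
  by rewrite /udr_series -E /= subn1 -/(d _) mulrC mulKr.
elim: w b x uw => [|y w IHw] b x uw.
  by rewrite /d !expr0 mulr1 block_series1 mul1r !mulr1.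
have xy : x != y by move: uw; rewrite /= inE negb_or => /andP[/andP[]].
have uyw : uniq (y :: w) by case/andP: uw.
have -> : d (size (y :: w)) = d (size w) * (1 - fps_t ^+ 2).
  by rewrite /d [_ ^+ size (y :: w)]exprSr mulrA.
rewrite -mulrA block_series_step // mulrCA IHw // run_count_cons2.
have := run_count_bounds (x < y)%N y w; set r := run_count _ _ => /andP[r1 r2].
have [_|bd] := eqVneq b (x < y)%N; rewrite /=.
  rewrite add0n (_ : size (x :: y :: w) - r = (size (y :: w) - r).+1)%N; last first.
    by rewrite subSn.
  by rewrite (exprS (1 + fps_t ^+ 2)) mulrCA.
by rewrite add1n !subSS subn0 subn1 mulrA mulrACA -!exprS prednK.
Qed.

Lemma udr_series_small n j m : (m < j)%N -> udr_series n j m = 0.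
Proof.
move=> mj; rewrite /udr_series [_ * fps_t ^+ j]mulrC -!mulrA.
by rewrite fps_t_exp_mul mj.
Qed.

(** This coefficient is the constant term of the cofactor of [t^j], a product of units. *)
Lemma udr_series_diag n j : udr_series n j j != 0.
Proof.
rewrite /udr_series [_ * fps_t ^+ j]mulrC -!mulrA fps_t_exp_mul ltnn subnn.
rewrite -fps_unitE !(unitrM, unitrV) !unitrX ?unit_1Bt ?unit_1Bt2 //.
by rewrite fps_unitE !fps_coef0E expr0n addr0 oner_neq0.
Qed.

End Series.

(** * Triangular families *)

Section Independence.
Variables (F : fieldType) (I : eqType) (s : seq I) (ix : I -> nat).
Variables (h : nat -> nat -> F) (c : I -> F).

(** Strong induction on the index: in degree [ix i] the terms of larger index vanish by
    triangularity, those of smaller index by induction. Compatibility, injectivity and dimension all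
    rest on this. *)
Lemma triangular_independent : uniq s -> {in s &, injective ix} ->
  (forall j k, (k < j)%N -> h j k = 0) -> (forall j, h j j != 0) ->
  (forall k, \sum_(i <- s) c i * h (ix i) k = 0) ->
  {in s, forall i, c i = 0}.
Proof.
move=> us inj_ix h0 hn0 sum0 i.
have [n] := ubnP (ix i); elim: n i => // n IHn i; rewrite ltnS => iN si.
have := sum0 (ix i); rewrite (bigD1_seq i) //= big_seq_cond big1 ?addr0 => [|j].
  by move/eqP; rewrite mulf_eq0 (negbTE (hn0 _)) orbF => /eqP.
case/andP => sj ji; case: (ltngtP (ix j) (ix i)) => [lt|gt|e].
- by rewrite IHn ?mul0r // (leq_trans lt).
- by rewrite h0 ?mulr0.
- by move: ji; rewrite (inj_ix _ _ sj si e) eqxx.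
Qed.

End Independence.

(** * Shuffle compatibility *)

Section Udr.
Implicit Types p q r : permutation.

Lemma udr_run_count p : udr p = run_count true (word p).
Proof. by rewrite /= num_udrE ?uniq_word. Qed.

Lemma udr_bounds p : (0 < size (word p))%N -> (1 <= udr p <= size (word p))%N.
Proof.
by rewrite udr_run_count; case: (word p) => // x w _; apply: run_count_bounds.
Qed.

(* Only (n, j) = (0, 0), with the series 1/(1 - t), occurs for n = 0; the other
   junk values at n = 0 keep the family triangular. *)
Definition udr_coef (n j : nat) : fps :=
  if n == 0%N then fun k => (j <= k)%:R else udr_series n j.

Lemma udr_coef_small n j k : (k < j)%N -> udr_coef n j k = 0.
Proof.
rewrite /udr_coef; case: ifP => _ kj; last exact: udr_series_small.
by rewrite leqNgt kj.
Qed.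

Lemma udr_coef_diag n j : udr_coef n j j != 0.
Proof.
by rewrite /udr_coef; case: ifP => _; rewrite ?udr_series_diag // leqnn oner_neq0.
Qed.

Lemma block_series_udr p : block_series true (word p) = udr_coef (size (word p)) (udr p).
Proof.
rewrite udr_run_count /udr_coef; have := uniq_word p.
case: (word p) => [|x w] uw; last by rewrite block_series_run_count.
by apply/funext => k; rewrite /block_series block_count_nil.
Qed.

Lemma udr_imageE p : udr_image p = hmonom (block_series true (word p)) (size (word p)).
Proof.
rewrite block_series_udr /udr_image /udr_coef; case: ifP => // /eqP sp0.
have -> : udr p = 0%N by rewrite udr_run_count (size0nil sp0).
by rewrite inv_1Bt sp0.
Qed.

Lemma sum_block_series_shuffles k p q : disjoint_perm p q ->
  \sum_(r <- shuffles p q) block_series true (word r) k =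
    block_series true (word p) k * block_series true (word q) k.
Proof.
move=> dpq; rewrite /block_series -natrM -sum_block_count_shuffles ?uniq_cat_disjoint //.
rewrite -natr_sum; congr _%:R; rewrite -(perm_big _ (perm_word_shuffles_shuffles dpq)).
by rewrite big_map.
Qed.

(** Grouping a sum by values turns a multiset into a vector of multiplicities. *)
Lemma sum_count_mem (R : pzSemiRingType) (I : eqType) (s u : seq I) (f : I -> R) :
  uniq u -> {subset s <= u} ->
  \sum_(j <- u) (count_mem j s)%:R * f j = \sum_(j <- s) f j.
Proof.
move=> uu; elim: s => [|x s IHs] su.
  by rewrite big_nil big1 // => j _; rewrite mul0r.
rewrite big_cons -IHs => [|j js]; last by apply: su; rewrite inE js orbT.
under eq_bigr do rewrite /= natrD mulrDl.
rewrite big_split /= (bigD1_seq x) ?su ?mem_head //= eqxx mul1r big1 ?addr0 //.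
by move=> j jx; rewrite eq_sym (negbTE jx) mul0r.
Qed.

(** Weighted with the series [udr_coef n], both multisets have the same sum by multiplicativity;
    independence of these series then equates the multiplicities. *)
Lemma udr_shuffle_compatible : shuffle_compatible udr.
Proof.
move=> p p' q q' dpq dpq' szp szq up uq.
set s := map _ _; set s' := map _ _.
pose n := (size (word p) + size (word q))%N.
have sumE (p1 q1 : permutation) k : disjoint_perm p1 q1 ->
    (size (word p1) + size (word q1))%N = n ->
    \sum_(j <- [seq udr r | r <- shuffles p1 q1]) udr_coef n j k =
      udr_coef (size (word p1)) (udr p1) k * udr_coef (size (word q1)) (udr q1) k.
  move=> d n1; rewrite -!block_series_udr -sum_block_series_shuffles // big_map.
  by apply: eq_big_seq => r /size_shuffles sr; rewrite block_series_udr sr n1.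
apply/allP => j js /=; apply/eqP/eqP; rewrite -(Num.Theory.eqr_nat rat) -subr_eq0; apply/eqP.
apply: (triangular_independent (s := undup (s ++ s')) (ix := id)
  (h := udr_coef n) (c := fun j => (count_mem j s)%:R - (count_mem j s')%:R)).
- exact: undup_uniq.
- by [].
- exact: udr_coef_small.
- exact: udr_coef_diag.
- move=> k; under eq_bigr do rewrite mulrBl.
  rewrite sumrB !sum_count_mem ?undup_uniq //.
  + by rewrite !sumE /n ?szp ?szq ?up ?uq ?subrr.
  + by move=> i si; rewrite mem_undup mem_cat si orbT.
  + by move=> i si; rewrite mem_undup mem_cat si.
- by rewrite mem_undup.
Qed.

(** * Words with a prescribed number of runs *)

Lemma run_count_map_S b w : run_count b (map S w) = run_count b w.
Proof.
elim: w b => // x [|y w] // IHw b.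
by rewrite [map _ _]/= !run_count_cons2 ltnS -IHw.
Qed.

(** Words grow at the front by a letter smaller or larger than all others, which sets the first
    direction at will. *)
Lemma exists_word_run_count b n j : (1 <= j <= n)%N ->
  exists w, [/\ uniq w, all (leq 1) w, size w = n & run_count b w = j].
Proof.
elim: n b j => [|n IHn] b j; first by case: j.
have prepend d w : uniq w -> all (leq 1) w -> (0 < size w)%N ->
    exists v, [/\ uniq v, all (leq 1) v, size v = (size w).+1 &
               run_count b v = (b != d) + run_count d w]%N.
  case: w => // y w uw pw _; case: d.
    (* Raising all letters by one frees 1 as a new positive minimum. *)
    exists (1%N :: map S (y :: w)); split.
    - rewrite cons_uniq map_inj_uniq ?uw ?andbT; last by move=> ? ? [].
      apply/mapP => -[x xw [x0]]; have := allP pw x xw.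
      by rewrite -x0.
    - by apply/andP; split=> //; apply/allP => _ /mapP[x _ ->].
    - by rewrite /= size_map.
    - have y0 : (0 < y)%N by case/andP: pw.
      by rewrite [map _ _]/= run_count_cons2 ltnS y0 -(run_count_map_S _ (y :: w)).
  exists ((sumn (y :: w)).+1 :: y :: w).
  have bound x : x \in y :: w -> (x <= sumn (y :: w))%N by apply: mem_leq_sumn.
  split=> //.
  - by rewrite cons_uniq uw andbT; apply/negP => /bound; rewrite ltnn.
  - rewrite run_count_cons2.
    have -> // : ((sumn (y :: w)).+1 < y)%N = false.
    by have := bound y (mem_head _ _); lia.
(* The largest value needs a change of direction at the new letter; a smaller one is reached with
   the direction kept. *)
case/andP => j1; rewrite leq_eqVlt ltnS => /orP[/eqP-> {j j1}|jn].
  case: n => [|n] in IHn *; first by exists [:: 1%N].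
  have [|w [uw pw sw rw]] := IHn (~~ b) n.+1; first by rewrite leqnn.
  have [|v [uv pv sv rv]] := prepend (~~ b) w uw pw; first by rewrite sw.
  by exists v; split=> //; rewrite ?sv ?sw // rv rw; case: (b).
have [|w [uw pw sw rw]] := IHn b j; first by rewrite j1.
have [|v [uv pv sv rv]] := prepend b w uw pw; first by rewrite sw (leq_trans j1).
by exists v; split=> //; rewrite ?sv ?sw // rv rw eqxx.
Qed.

Lemma exists_perm_udr n j : (1 <= j <= n)%N ->
  exists p : permutation, size (word p) = n /\ udr p = j.
Proof.
move=> /(exists_word_run_count true)[w [uw pw sw rw]].
have wP : uniq w && all (leq 1) w by rewrite uw.
by exists (Permutation wP); rewrite udr_run_count.
Qed.

End Udr.

(** * Linear spans *)

Section Lspan.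
Variables (F : fieldType) (V : lmodType F) (X : set V).

Lemma lspan_gen x : X x -> x \in lspan X.
Proof.
move=> Xx; apply/asboolP; exists [:: (1, x)]; split=> [p|].
  by rewrite inE => /eqP->.
by rewrite big_seq1 scale1r.
Qed.

Lemma lspan0 : 0 \in lspan X.
Proof. by apply/asboolP; exists [::]; rewrite big_nil. Qed.

Lemma lspan_linear_closed : linear_closed (lspan X).
Proof.
move=> a u v /asboolP[s [sX ->]] /asboolP[t [tX ->]]; apply/asboolP.
exists ([seq (a * p.1, p.2) | p <- s] ++ t); split=> [p|].
  by rewrite mem_cat => /orP[/mapP[q /sX qX ->]|/tX].
rewrite big_cat big_map scaler_sumr; congr (_ + _).
by apply: eq_bigr => p _; rewrite scalerA.
Qed.

Lemma lspan_ind (P : V -> Prop) : P 0 ->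
  (forall a u v, P u -> P v -> P (a *: u + v)) ->
  (forall x, X x -> P x) -> forall v, v \in lspan X -> P v.
Proof.
move=> P0 PD PX v /asboolP[s [sX ->]].
rewrite big_seq; elim/big_rec: _ => // p u /sX /PX Pp Pu; exact: PD.
Qed.

End Lspan.

(** * The isomorphism *)

Lemma hmonom_coef F n m k : (hmonom F n)`_m k = if m == n then F k else 0.
Proof. by rewrite /hmonom coefCM coefXn; case: eqP => _; rewrite ?mulr1 ?mulr0. Qed.

Lemma hmonomM F G n m : hmonom F n * hmonom G m = hmonom (had F * had G : hfps) (n + m).
Proof. by rewrite /hmonom /had exprD mulrACA -polyCM. Qed.

Lemma hpoly_coef_sum (I : Type) (s : seq I) (f : I -> hpoly) m k :
  (\sum_(i <- s) f i)`_m k = \sum_(i <- s) (f i)`_m k.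
Proof.
by apply: (big_morph (fun v : hpoly => v`_m k)) => [u v|]; rewrite ?coefD ?coef0.
Qed.

Lemma hpolyP (u v : hpoly) : (forall m k, u`_m k = v`_m k) -> u = v.
Proof. by move=> uv; apply/polyP => m; apply/funext => k. Qed.

Lemma udr_image_coef p m k :
  (udr_image p)`_m k =
    if m == size (word p) then udr_coef (size (word p)) (udr p) k else 0.
Proof. by rewrite udr_imageE block_series_udr hmonom_coef. Qed.

(** The Hadamard product treats each coefficient of [t^k] separately, so multiplicativity of the cut
    counts applies for each [k]. *)
Lemma udr_image_mul (p q : permutation) : disjoint_perm p q ->
  udr_image p * udr_image q = \sum_(r <- shuffles p q) udr_image r.
Proof.
move=> dpq; rewrite !udr_imageE hmonomM; apply: hpolyP => m k.
rewrite hmonom_coef hpoly_coef_sum hadM -sum_block_series_shuffles //.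
transitivity (\sum_(r <- shuffles p q)
    if m == (size (word p) + size (word q))%N then block_series true (word r) k else 0).
  by case: eqP => // _; rewrite big1.
by apply: eq_big_seq => r /size_shuffles sr; rewrite udr_imageE hmonom_coef sr.
Qed.

Section UdrIsomorphism.
Variable udr_sc : shuffle_compatible udr.
Local Notation A := (shuffle_algebra udr_sc).

Definition udr_map : A -> hpoly := malg_lift (fun c : st_class udr => udr_image (repr c)).

Lemma udr_map_linear : linear udr_map.
Proof. exact: malg_lift_is_linear. Qed.

HB.instance Definition _ :=
  GRing.isLinear.Build rat A hpoly *:%R udr_map udr_map_linear.

(** The image depends only on the length and on [udr], so the chosen representative is
    immaterial. *)
Lemma udr_map_basis p : udr_map (basis_class udr_sc p) = udr_image p.
Proof.
rewrite /udr_map malg_liftU /udr_image.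
by have /andP[/eqP-> /eqP->] := st_equiv_repr udr p.
Qed.

Lemma shuffle_algebra_ind (P : A -> Prop) : P 0 ->
  (forall c g h, P g -> P h -> P (c *: g + h)) ->
  (forall p, P (basis_class udr_sc p)) -> forall a, P a.
Proof.
move=> P0 PD PU; apply: (malg_ind P0 PD) => c.
by rewrite -(class_of_repr c); apply: PU.
Qed.

Lemma disjoint_basis p q : exists q',
  disjoint_perm p q' /\ basis_class udr_sc q' = basis_class udr_sc q.
Proof.
exists (shift (sumn p) q); rewrite disjoint_shift //; split=> //.
by rewrite /basis_class class_of_shift.
Qed.

Lemma udr_map_monoid_morphism : monoid_morphism udr_map.
Proof.
split=> [|a b].
  rewrite -[LHS]/(udr_map (basis_class udr_sc empty_perm)) udr_map_basis.
  by apply: hpolyP => m k; rewrite udr_image_coef coef1; case: eqP.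
(* Linearity in the left factor reduces to basis classes; commutativity makes it serve for the right
   factor too. *)
have mapMl c (g h d : A) :
    udr_map (g * d) = udr_map g * udr_map d -> udr_map (h * d) = udr_map h * udr_map d ->
    udr_map ((c *: g + h) * d) = udr_map (c *: g + h) * udr_map d.
  by move=> Hg Hh; rewrite mulrDl -scalerAl !udr_map_linear mulrDl -scalerAl Hg Hh.
elim/shuffle_algebra_ind: a => [|c g h Hg Hh|p].
- by rewrite mul0r linear0 mul0r.
- exact: mapMl.
rewrite mulrC [RHS]mulrC; elim/shuffle_algebra_ind: b => [|c g h Hg Hh|q].
- by rewrite mul0r linear0 mul0r.
- exact: mapMl.
rewrite mulrC [RHS]mulrC.
have [q' [dpq <-]] := disjoint_basis p q.
rewrite basis_class_mul // !udr_map_basis udr_image_mul // linear_sum.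
by apply: eq_bigr => r _; apply: udr_map_basis.
Qed.

HB.instance Definition _ :=
  GRing.isMonoidMorphism.Build A hpoly udr_map udr_map_monoid_morphism.

(** Only classes of length [m] reach [x^m], which isolates one triangular family for each length. *)
Lemma udr_map_coef a m k :
  (udr_map a)`_m k =
    \sum_(c <- [seq c <- msupp a | size (word (repr c)) == m])
      a@_c * udr_coef m (udr (repr c)) k.
Proof.
rewrite /udr_map /malg_lift hpoly_coef_sum big_filter [RHS]big_mkcond.
apply: eq_bigr => c _; rewrite hpoly_scaleE udr_image_coef eq_sym.
by case: eqP => [->|_]; rewrite ?mulr0.
Qed.

(** At a fixed length [udr] determines the class, so the triangular family is indexed injectively
    and every coefficient of an element of the kernel vanishes. *)
Lemma udr_map_injective : injective udr_map.
Proof.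
apply: raddf_inj => a a0; apply/malgP => c; rewrite mcoeff0.
have [ca|/mcoeff_outdom //] := boolP (c \in msupp a).
pose m := size (word (repr c)).
apply: (triangular_independent (s := [seq c <- msupp a | size (word (repr c)) == m])
  (ix := fun c => udr (repr c)) (h := udr_coef m) (c := fun c => a@_c)).
- by rewrite filter_uniq ?fset_uniq.
- move=> d e; rewrite !mem_filter => /andP[/eqP sd _] /andP[/eqP se _] de.
  rewrite -(class_of_repr d) -(class_of_repr e); apply/class_ofP.
  by rewrite /st_equiv sd se de !eqxx.
- exact: udr_coef_small.
- exact: udr_coef_diag.
- by move=> k; rewrite -udr_map_coef a0 coef0.
- by rewrite mem_filter eqxx.
Qed.

(** Every [j] from 1 to [n] is attained by a permutation of length [n], so each generator is the
    image of a class; [udr_bounds] gives the converse. *)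
Lemma udr_span_image (v : hpoly) : v \in udr_span <-> exists a, udr_map a = v.
Proof.
split=> [|[a <-]].
  elim/lspan_ind: v / => [|c u v [a <-] [b <-]|v].
  - by exists 0; rewrite linear0.
  - by exists (c *: a + b); rewrite udr_map_linear.
  case=> [->|[n [j [n1 jn ->]]]].
    by exists (basis_class udr_sc empty_perm); rewrite udr_map_basis.
  have [p [sp up]] := exists_perm_udr jn.
  exists (basis_class udr_sc p); rewrite udr_map_basis /udr_image sp up.
  by case: n n1 {jn sp}.
elim/shuffle_algebra_ind: a => [|c g h Hg Hh|p].
- by rewrite linear0 lspan0.
- by rewrite udr_map_linear lspan_linear_closed.
rewrite udr_map_basis; apply: lspan_gen; rewrite /udr_image /=.
have [sp|] := posnP (size (word p)); first by left.
move=> sp; right; exists (size (word p)), (udr p).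
by split=> //; apply: udr_bounds.
Qed.

Lemma udr_span_subalg_closed : GRing.subalg_closed udr_span.
Proof.
split; last 2 first.
- exact: lspan_linear_closed.
- move=> u v /udr_span_image[a <-] /udr_span_image[b <-].
  by apply/udr_span_image; exists (a * b); rewrite rmorphM.
by apply/udr_span_image; exists 1; rewrite rmorph1.
Qed.

(** One permutation for each value of [udr] from 1 to [n] represents all classes of length [n]; the
    coefficient of [x^n] in the image reduces independence to the triangular family. *)
Lemma homogeneous_has_dim n : (1 <= n)%N -> has_dim (homogeneous udr_sc n) n.
Proof.
move=> n1.
have /choice[p pP] : forall i : 'I_n, exists p : permutation,
    size (word p) = n /\ udr p = i.+1.
  by move=> i; apply: exists_perm_udr; exact: ltn_ord.
exists (fun i => basis_class udr_sc (p i)); split.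
- by move=> i; apply: lspan_gen; exists (p i) => //; have [] := pP i.
- move=> c c0 i.
  apply: (triangular_independent (s := enum 'I_n) (ix := fun i => i.+1)
    (h := udr_coef n) (c := c)).
  + exact: enum_uniq.
  + by move=> j l _ _ [] /val_inj.
  + exact: udr_coef_small.
  + exact: udr_coef_diag.
  + move=> k; rewrite big_enum /=.
    transitivity ((udr_map (\sum_(j < n) c j *: basis_class udr_sc (p j)))`_n k).
      rewrite linear_sum hpoly_coef_sum; apply: eq_bigr => j _; have [sp up] := pP j.
      by rewrite linearZ hpoly_scaleE /= udr_map_basis udr_image_coef sp up eqxx.
    by rewrite c0 linear0 coef0.
  + by rewrite mem_enum.
move=> v; elim/lspan_ind: v / => [|a u v [c ->] [d ->]|_ [q /= sq <-]].
- by exists (fun=> 0); rewrite big1 // => i _; rewrite scale0r.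
- exists (fun i => a * c i + d i); rewrite scaler_sumr -big_split.
  by apply: eq_bigr => i _; rewrite scalerA scalerDl.
have /andP[u1 un] : (1 <= udr q <= n)%N by rewrite -sq udr_bounds // sq.
(* Ordinals start at 0 and [udr] at 1, hence the predecessor. *)
have lt : ((udr q).-1 < n)%N by rewrite prednK.
exists (fun i => (i == Ordinal lt)%:R).
rewrite (bigD1 (Ordinal lt)) //= eqxx scale1r big1 ?addr0 => [|i /negbTE->]; last first.
  by rewrite scale0r.
have [sp up] := pP (Ordinal lt).
congr << _ >>; apply/class_ofP.
by rewrite /st_equiv sp up sq /= prednK // !eqxx.
Qed.

End UdrIsomorphism.

Theorem theorem5p12 :
  shuffle_compatible udr /\
  forall udr_sc : shuffle_compatible udr,
    (exists phi : {lrmorphism shuffle_algebra udr_sc -> hpoly},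
       [/\ forall p : permutation, phi (basis_class udr_sc p) = udr_image p,
           injective phi,
           forall v : hpoly, v \in udr_span <-> exists a, phi a = v
         & GRing.subalg_closed udr_span]) /\
    (forall n : nat, (1 <= n)%N -> has_dim (homogeneous udr_sc n) n).
Proof.
split=> [|udr_sc]; first exact: udr_shuffle_compatible.
split; last exact: homogeneous_has_dim.
exists (@udr_map udr_sc); split.
- exact: udr_map_basis.
- exact: udr_map_injective.
- exact: udr_span_image.
- exact: udr_span_subalg_closed udr_sc.
Qed.
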